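(* (Group privacy) If a mechanism $M(\cdot,\cdot)$ is $\epsilon$-HDP, and $D$ and $D'$ are $k$-neighbor datasets, i.e. $\|D-D'\|_H=k$, then $$D_{HD}(M(w,D),M(w,D'))\le k^2\epsilon.$$ That is, for any $k$-neighbor datasets, the mechanism is $k^2\epsilon$-HDP.
   Context: Datasets are elements $D=(x_1,\dots,x_n)$ of a database $\mathcal{D}\subset\mathbb{R}^n$. The Hamming distance $\|D-D'\|_H$ is the number of indices $i$ with $x_i\ne x_i'$; $D,D'$ are adjacent if $\|D-D'\|_H=1$. $D,D'$ are $k$-neighbor datasets if there exist datasets $D=D_0,D_1,\dots,D_k=D'$ in $\mathcal{D}$ such that $D_i$ and $D_{i+1}$ are adjacent or identical for $i=0,\dots,k-1$; the paper expresses this as $\|D-D'\|_H=k$. A query is a measurable map $W:\mathcal{D}\to\mathbb{R}^m$, $w=W(D)$; a mechanism $M$ is a randomized algorithm producing, for each dataset, a random vector $M(w,D)\in\mathbb{R}^m$ with a Lebesgue density (the query being evaluated at the respective dataset). For laws $P_1,P_2$ with densities $p_1,p_2$, $D_{HD}(P_1,P_2)=\int_{\mathbb{R}^m}(\sqrt{p_1(x)}-\sqrt{p_2(x)})^2dx$. $M$ is $\epsilon$-HDP ($\epsilon\in[0,2]$) if $D_{HD}(M(w,D),M(w,D'))\le\epsilon$ for all adjacent $D,D'$. *)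

(* Defs.v *)
From HB Require Import structures.
From mathcomp Require Import all_boot all_order all_algebra.
From mathcomp Require Import all_classical all_reals all_analysis.
From mathcomp Require Import measurable_realfun.

Set Implicit Arguments.
Unset Strict Implicit.
Unset Printing Implicit Defensive.

Import Order.TTheory GRing.Theory Num.Theory.
Import numFieldNormedType.Exports.

Local Open Scope classical_set_scope.
Local Open Scope ring_scope.

(* R^n is [n.-tuple R] with the library's product sigma-algebra.  The library
   has Lebesgue measure on R only; on R^n it is built here as the n-fold
   product, as a sigma-finite measure so that Radon-Nikodym derivatives with
   respect to it are available. *)

Section lebesgue_cons.
Context {R : realType} (n : nat).
Variable mu : {sigma_finite_measure set (n.-tuple R) -> \bar R}.

Definition consp (p : measurableTypeR R * n.-tuple R) : n.+1.-tuple R :=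
  [tuple of p.1 :: p.2].

Definition lebesgue_cons : set (n.+1.-tuple R) -> \bar R :=
  pushforward (lebesgue_measure \x mu)%E consp.

Let mconsp : measurable_fun [set: measurableTypeR R * n.-tuple R] consp.
Proof. exact: measurable_cons. Qed.

Let lebesgue_cons0 : lebesgue_cons set0 = 0%E.
Proof. by rewrite /lebesgue_cons /pushforward preimage_set0 measure0. Qed.

Let lebesgue_cons_ge0 A : (0 <= lebesgue_cons A)%E.
Proof. exact: measure_ge0. Qed.

Let lebesgue_cons_sigma_additive : semi_sigma_additive lebesgue_cons.
Proof.
exact: (@measure_semi_sigma_additive _ _ _
  (measure_function_pushforward__canonical__measure_function_Measure
    (lebesgue_measure \x mu)%E mconsp)).
Qed.

HB.instance Definition _ := isMeasure.Build _ _ _ lebesgue_cons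
  lebesgue_cons0 lebesgue_cons_ge0 lebesgue_cons_sigma_additive.

Let consKV (p : measurableTypeR R * n.-tuple R) :
  (thead (consp p), [tuple of behead (consp p)]) = p.
Proof.
by case: p => x t; congr pair; apply/val_inj.
Qed.

Let lebesgue_cons_sigma_finite : sigma_finite setT lebesgue_cons.
Proof.
have /sigma_finiteP[F [TF ndF Foo]] := sigma_finiteT (@lebesgue_measure R).
have /sigma_finiteP[G [TG ndG Goo]] := sigma_finiteT mu.
pose g (t : n.+1.-tuple R) : measurableTypeR R * n.-tuple R :=
  (thead t, [tuple of behead t]).
have mg : measurable_fun setT g.
  apply: measurable_fun_pair; last exact: measurable_behead.
  exact: measurable_tnth.
exists (fun i => g @^-1` (F i `*` G i)).
  apply/esym; rewrite -subTset => t _.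
  have : (\bigcup_i F i) (thead t) by rewrite -TF.
  move=> [i _ Fi]; have : (\bigcup_i G i) [tuple of behead t] by rewrite -TG.
  move=> [k _ Gk]; exists (maxn i k) => //; split => /=.
    by move: Fi; exact/subsetPset/ndF/leq_maxl.
  by move: Gk; exact/subsetPset/ndG/leq_maxr.
move=> i; have [mF Fi] := Foo i; have [mG Gi] := Goo i; split.
  by rewrite -[X in measurable X]setTI; apply: mg => //; exact: measurableX.
rewrite /lebesgue_cons /pushforward.
have -> : consp @^-1` (g @^-1` (F i `*` G i)) = F i `*` G i.
  have gK p : g (consp p) = p by exact: consKV.
  by apply/funext=> p; rewrite /preimage /mkset gK.
by rewrite product_measure1E// lte_mul_pinfty// ge0_fin_numE.
Qed.

HB.instance Definition _ := Measure_isSigmaFinite.Build _ _ _ lebesgue_cons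
  lebesgue_cons_sigma_finite.

End lebesgue_cons.

Fixpoint lebesgue_tuple {R : realType} (n : nat) :
    {sigma_finite_measure set (n.-tuple R) -> \bar R} :=
  match n with
  | 0 => dirac [tuple]
  | n'.+1 => lebesgue_cons (lebesgue_tuple n')
  end.

Lemma lebesgue_tuple_box (R : realType) (n : nat)
    (A : 'I_n -> set (measurableTypeR R)) :
  (forall i, measurable (A i)) ->
  lebesgue_tuple n [set t | forall i, A i (tnth t i)] =
  (\prod_(i < n) lebesgue_measure (A i))%E.
Proof.
elim: n A => [|n IHn] A mA /=.
  by rewrite big_ord0 /dirac indicE mem_set// => -[].
rewrite big_ord_recl -IHn// -product_measure1E//.
- rewrite /lebesgue_cons /pushforward; congr ((_ \x _)%E _).
  apply/seteqP; split=> -[x t] /=.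
    move=> h; split; first by have := h ord0.
    by move=> i; have := h (lift ord0 i); rewrite tnthS.
  move=> [A0 At] i; have [j ->|-> //] := unliftP ord0 i.
  by rewrite tnthS; exact: At.
- rewrite [X in measurable X](_ : _ =
    \bigcap_(i in [set: 'I_n]) ((fun t => tnth t i) @^-1` A (lift ord0 i))).
    apply: fin_bigcap_measurable => // i _.
    rewrite -[X in measurable X]setTI.
    exact: (@measurable_tnth _ (measurableTypeR R) n i).
  by apply/seteqP; split=> t /= h i; [move=> _|]; exact: h.
Qed.

Section hellinger.
Context {R : realType} {m : nat}.
Local Open Scope charge_scope.
Implicit Types P Q : probability (m.-tuple R) R.

Definition has_density P (p : m.-tuple R -> R) : Prop :=
  [/\ measurable_fun [set: m.-tuple R] p,
      forall x, 0 <= p x &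
      forall A, measurable A ->
        P A = (\int[lebesgue_tuple m]_(x in A) (p x)%:E)%E].

Definition density P : m.-tuple R -> R :=
  fine \o 'd (charge_of_finite_measure P) '/d (lebesgue_tuple m).

Definition hellinger P Q : \bar R :=
  (\int[lebesgue_tuple m]_x
    ((Num.sqrt (density P x) - Num.sqrt (density Q x)) ^+ 2)%:E)%E.

Lemma has_density_ae_eq P p : has_density P p ->
  ae_eq (lebesgue_tuple m) setT (density P) p.
Proof.
move=> [mp p0 Pp].
have Pmu : charge_of_finite_measure P `<< lebesgue_tuple m.
  apply/null_content_dominatesP => A mA A0.
  rewrite /charge_of_finite_measure/= Pp//.
  apply: null_set_integral => //.
  by apply/measurable_EFinP; exact: measurable_funS mp.
have RNp : ae_eq (lebesgue_tuple m) setT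
    ('d (charge_of_finite_measure P) '/d (lebesgue_tuple m)) (EFin \o p).
  apply: integral_ae_eq => //.
  - exact: Radon_Nikodym_integrable.
  - exact/measurable_EFinP.
  - move=> A _ mA; rewrite -Radon_Nikodym_integral//.
    exact: Pp.
by apply: filterS RNp => x /= h /h; rewrite /density/= => ->.
Qed.

Lemma measurable_density P : measurable_fun setT (density P).
Proof.
apply: measurableT_comp => //.
have [Pmu|Pmu] := pselect (charge_of_finite_measure P `<< lebesgue_tuple m).
  by apply: measurable_int; exact: Radon_Nikodym_integrable.
by rewrite /Radon_Nikodym; case: pselect.
Qed.

Lemma hellingerE P Q p q : has_density P p -> has_density Q q ->
  hellinger P Q = (\int[lebesgue_tuple m]_x
    ((Num.sqrt (p x) - Num.sqrt (q x)) ^+ 2)%:E)%E.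
Proof.
move=> Pp Qq.
have mF (f g : m.-tuple R -> R) : measurable_fun setT f ->
    measurable_fun setT g ->
    measurable_fun setT (fun x => ((Num.sqrt (f x) - Num.sqrt (g x)) ^+ 2)%:E).
  move=> mf mg; apply/measurable_EFinP; apply: measurable_funX.
  have msqrt : measurable_fun setT (@Num.sqrt R).
    by apply: continuous_measurable_fun; apply: sqrt_continuous.
  by apply: measurable_funB; [exact: measurableT_comp msqrt mf|
    exact: measurableT_comp msqrt mg].
apply: ae_eq_integral => //.
- by apply: mF; exact: measurable_density.
- by apply: mF; [case: Pp|case: Qq].
apply: filterS2 (has_density_ae_eq Pp) (has_density_ae_eq Qq).
by move=> x /= hp hq xT; rewrite hp// hq.
Qed.

End hellinger.

Section differential_privacy.
Context {R : realType} {n m : nat}.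

Definition hamming (D D' : n.-tuple R) : nat :=
  #|[pred i : 'I_n | tnth D i != tnth D' i]|.

Definition adjacent (D D' : n.-tuple R) : Prop := hamming D D' = 1%N.

Definition neighbors (database : set (n.-tuple R)) (k : nat)
    (D D' : n.-tuple R) : Prop :=
  exists s : nat -> n.-tuple R,
    [/\ s 0%N = D, s k = D',
        forall i, (i <= k)%N -> database (s i) &
        forall i, (i < k)%N -> adjacent (s i) (s i.+1) \/ s i = s i.+1].

(* Measurability for the trace sigma-algebra on the database, which need not
   itself be a measurable set; [measurable_fun database W] would hold vacuously
   for a non-measurable database. *)
Definition query (database : set (n.-tuple R)) (W : n.-tuple R -> m.-tuple R) :
    Prop :=
  preimage_set_system database W measurable `<=` strace measurable database.

Context {d : measure_display} {Omega : measurableType d}.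
Variable P : probability Omega R.

Definition mechanism_output
    (M : m.-tuple R -> n.-tuple R -> {RV P >-> m.-tuple R})
    (W : n.-tuple R -> m.-tuple R) (D : n.-tuple R) :
    probability (m.-tuple R) R :=
  distribution P (M (W D) D).

Definition mechanism (database : set (n.-tuple R))
    (W : n.-tuple R -> m.-tuple R)
    (M : m.-tuple R -> n.-tuple R -> {RV P >-> m.-tuple R}) : Prop :=
  forall D, database D -> exists p, has_density (mechanism_output M W D) p.

Definition HDP (database : set (n.-tuple R)) (W : n.-tuple R -> m.-tuple R)
    (M : m.-tuple R -> n.-tuple R -> {RV P >-> m.-tuple R}) (eps : R) : Prop :=
  forall D D', database D -> database D' -> adjacent D D' ->
    (hellinger (mechanism_output M W D) (mechanism_output M W D') <= eps%:E)%E.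

End differential_privacy.

(* Main.v *)
Require Import Defs.
From mathcomp Require Import all_boot all_order all_algebra.
From mathcomp Require Import all_classical all_reals all_analysis.
From mathcomp Require Import measurable_realfun.
From mathcomp Require Import ring.

Import Order.TTheory GRing.Theory Num.Theory.
Import numFieldNormedType.Exports.

Local Open Scope classical_set_scope.
Local Open Scope ring_scope.

(* The map sending P to the square root of its density embeds probabilities in
   L^2, and [hellinger] is the squared distance there. Along a chain of k steps
   of squared length at most eps, the weighted inequality
   (a + b)^2 <= (1 + 1/j) a^2 + (1 + j) b^2 propagates the bound j^2 eps to
   (1 + 1/j) j^2 eps + (1 + j) eps = (j + 1)^2 eps. *)

(** The two sides differ by a nonnegative multiple of a square: this is weighted AM-GM applied to
    the cross term [2 (x - y) (y - z)]. *)
Lemma sqr_sub_le_weighted (R : realFieldType) (t x y z : R) : 0 < t ->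
  (x - z) ^+ 2 <= (1 + t^-1) * (x - y) ^+ 2 + (1 + t) * (y - z) ^+ 2.
Proof.
move=> t0; rewrite -subr_ge0.
suff -> : (1 + t^-1) * (x - y) ^+ 2 + (1 + t) * (y - z) ^+ 2 - (x - z) ^+ 2 =
    t^-1 * ((x - y) - t * (y - z)) ^+ 2.
  by rewrite mulr_ge0 ?sqr_ge0// invr_ge0 ltW.
by field; rewrite gt_eqF.
Qed.

Section hellinger_theory.
Context {R : realType} {m : nat}.
Implicit Types P Q S : probability (m.-tuple R) R.

Lemma measurable_hellinger_integrand P Q :
  measurable_fun setT (fun x =>
    ((Num.sqrt (density P x) - Num.sqrt (density Q x)) ^+ 2)%:E).
Proof.
have msqrt : measurable_fun setT (@Num.sqrt R).
  by apply: continuous_measurable_fun; exact: sqrt_continuous.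
apply/measurable_EFinP; apply: measurable_funX; apply: measurable_funB;
  by apply: (measurableT_comp msqrt); exact: measurable_density.
Qed.

Lemma hellinger_self P : hellinger P P = 0%E.
Proof. by apply: integral0_eq => x _; rewrite subrr expr0n. Qed.

(** The pointwise inequality between square roots of densities is integrated. This replaces
    Minkowski's inequality and keeps to squared distances throughout. *)
Lemma hellinger_weighted_triangle P Q S (t : R) : 0 < t ->
  (hellinger P S <=
    (1 + t^-1)%:E * hellinger P Q + (1 + t)%:E * hellinger Q S)%E.
Proof.
move=> t0.
have t1 : 0 <= 1 + t by rewrite addr_ge0 ?ltW.
have tV1 : 0 <= 1 + t^-1 by rewrite addr_ge0// invr_ge0 ltW.
(* All integrands are nonnegative, so linearity holds in the extended reals without any
   integrability condition. *)
rewrite /hellinger -!ge0_integralZl//; first last.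
- by move=> x _; rewrite lee_fin sqr_ge0.
- exact: measurable_hellinger_integrand.
- by move=> x _; rewrite lee_fin sqr_ge0.
- exact: measurable_hellinger_integrand.
have mZ a P' Q' := @measurable_funeM _ _ _ setT _ a%:E
  (measurable_hellinger_integrand P' Q').
rewrite -ge0_integralD//; first last.
- by move=> x _; rewrite lee_fin mulr_ge0 ?sqr_ge0.
- by move=> x _; rewrite lee_fin mulr_ge0 ?sqr_ge0.
apply: ge0_le_integral => //.
- by move=> x _; rewrite lee_fin sqr_ge0.
- exact: measurable_hellinger_integrand.
- exact: emeasurable_funD.
- by move=> x _; rewrite -!EFinM -EFinD lee_fin sqr_sub_le_weighted.
Qed.

Lemma hellinger_chain (F : nat -> probability (m.-tuple R) R) (eps : R)
    (k : nat) :
  (forall i, (i < k)%N -> (hellinger (F i) (F i.+1) <= eps%:E)%E) ->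
  (hellinger (F 0%N) (F k) <= (k%:R ^+ 2 * eps)%:E)%E.
Proof.
(* The weight will be the number of steps already made, which must be positive; hence chains of
   length 0 and 1 are settled first. *)
elim: k => [|[|k] IH] step.
- by rewrite hellinger_self expr0n mul0r.
- by rewrite expr1n mul1r step.
have k0 : 0 < k.+1%:R :> R by rewrite ltr0n.
have {}IH := IH (fun i ik => step i (ltnW ik)).
(* With [j = k.+1], the weight [t = j] minimises [(1 + 1/t) j^2 + (1 + t)]. *)
apply: le_trans (hellinger_weighted_triangle (F 0%N) (F k.+1) (F k.+2) _ k0) _.
have -> : k.+2%:R ^+ 2 * eps =
    (1 + k.+1%:R^-1) * (k.+1%:R ^+ 2 * eps) + (1 + k.+1%:R) * eps.
  rewrite -(natr1 k.+1); move: k.+1%:R k0 => j j0.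
  by field; rewrite gt_eqF.
rewrite [leRHS]EFinD; apply: leeD; rewrite EFinM lee_wpmul2l//.
exact: step.
Qed.

End hellinger_theory.

Theorem theorem2p4 (R : realType) (n m : nat)
    (database : set (n.-tuple R))
    (W : n.-tuple R -> m.-tuple R)
    (d : measure_display) (Omega : measurableType d) (P : probability Omega R)
    (M : m.-tuple R -> n.-tuple R -> {RV P >-> m.-tuple R})
    (eps : R) (k : nat) (D D' : n.-tuple R) :
  query database W ->
  mechanism database W M ->
  0 <= eps <= 2 ->
  HDP database W M eps ->
  neighbors database k D D' ->
  (hellinger (mechanism_output M W D) (mechanism_output M W D')
    <= (k%:R ^+ 2 * eps)%:E)%E.
Proof.
move=> _ _ /andP[eps0 _] hdp [s [<- <- sdb sadj]].
apply: (hellinger_chain (fun i => mechanism_output M W (s i))) => i ik.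
(* A step that stays in place has distance 0, which is within [eps] because [0 <= eps]. *)
have [adj|->] := sadj i ik; last by rewrite hellinger_self lee_fin.
by apply: hdp => //; apply: sdb => //; exact: ltnW.
Qed.
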